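(* For every $\varepsilon>0$ there exists $m_0=m_0(\varepsilon)$ such that the following holds. For every graph $G$ and every integer $m$ with $m_0\le m\le e(G)$, the random graph $G_m$ satisfies $q^*(G_m)>q^*(G)-\varepsilon$ with probability greater than $1-\varepsilon$.
   Context: Graphs are finite and simple; $e(G)$ is the number of edges of $G$. For a graph $G$ with $m\ge 1$ edges and a vertex partition $\mathcal{A}$ of $V(G)$, the modularity score is $q_{\mathcal{A}}(G)=\frac1m\sum_{A\in\mathcal{A}}e(A)-\frac1{4m^2}\sum_{A\in\mathcal{A}}\mathrm{vol}(A)^2$, where $e(A)$ is the number of edges of $G$ with both ends in $A$ and $\mathrm{vol}(A)$ is the sum of the degrees of the vertices in $A$. If $G$ has no edges then $q_{\mathcal{A}}(G)=0$. The modularity of $G$ is $q^*(G)=\max_{\mathcal{A}}q_{\mathcal{A}}(G)$ over all vertex partitions. $G_m$ is the random graph on the vertex set of $G$ whose edge set is a uniformly random $m$-element subset of $E(G)$. *)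

(* Defs.v *)
From HB Require Import structures.
From mathcomp Require Import all_boot all_order all_algebra.
From mathcomp Require Import reals.

Set Implicit Arguments.
Unset Strict Implicit.
Unset Printing Implicit Defensive.

Import Order.TTheory GRing.Theory Num.Theory.
Local Open Scope ring_scope.

Section Graph.
Variable V : finType.

Record sgraph := SGraph {
  edges : {set {set V}};
  edges_pairs : [forall e in edges, #|e| == 2] }.

HB.instance Definition _ := [isSub for edges].
HB.instance Definition _ := [Finite of sgraph by <:].

Definition edge_count (G : sgraph) : nat := #|edges G|.

Definition degree (G : sgraph) (v : V) : nat := #|[set e in edges G | v \in e]|.

Definition inner_edges (G : sgraph) (A : {set V}) : nat :=
  #|[set e in edges G | e \subset A]|.

Definition vol (G : sgraph) (A : {set V}) : nat :=
  (\sum_(v in A) degree G v)%N.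

Definition modularity_score (R : realType) (G : sgraph) (P : {set {set V}}) : R :=
  if edge_count G == 0%N then 0 else
    (edge_count G)%:R^-1 * (\sum_(A in P) (inner_edges G A)%:R)
    - (4%:R * (edge_count G)%:R ^+ 2)^-1 * (\sum_(A in P) (vol G A)%:R ^+ 2).

Definition singleton_partition : {set {set V}} := [set [set x] | x in V].

(* A maximum over a nonempty finite set: the base point of the iterated max is
   the score of a genuine partition; see modularity_ub and modularity_attained. *)
Definition modularity (R : realType) (G : sgraph) : R :=
  \big[Num.max/modularity_score R G singleton_partition]_(P : {set {set V}}
     | partition P [set: V]) modularity_score R G P.

Lemma singleton_partitionP : partition singleton_partition [set: V].
Proof.
apply/and3P; split.
- apply/eqP/setP => x; rewrite inE; apply/bigcupP.
  by exists [set x]; rewrite ?set11 //; apply/imsetP; exists x.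
- apply/trivIsetP => _ _ /imsetP[x _ ->] /imsetP[y _ ->] xy.
  by rewrite disjoints1 inE; apply: contra xy => /eqP->.
- by apply/imsetP => -[x _ /setP /(_ x)]; rewrite !inE eqxx.
Qed.

Lemma modularity_ub (R : realType) (G : sgraph) (P : {set {set V}}) :
  partition P [set: V] -> modularity_score R G P <= modularity R G.
Proof. by move=> hP; apply: (le_bigmax_cond _ (modularity_score R G)). Qed.

Lemma modularity_attained (R : realType) (G : sgraph) :
  exists2 P, partition P [set: V] & modularity R G = modularity_score R G P.
Proof.
rewrite /modularity.
elim/big_ind: _ => [|x y [P hP ->] [Q hQ ->]|P hP]; last by exists P.
- by exists singleton_partition => //; exact: singleton_partitionP.
- by rewrite /Num.max; case: ifP => _; [exists Q|exists P].
Qed.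

(* The possible outcomes of G_m: spanning subgraphs of G with m edges. *)
Definition edge_samples (G : sgraph) (m : nat) : {set sgraph} :=
  [set H : sgraph | (edges H \subset edges G) && (edge_count H == m)].

(* Probability of an event under the uniform distribution on edge_samples G m,
   which is nonempty exactly when m <= edge_count G. *)
Definition sample_prob (R : realType) (G : sgraph) (m : nat)
    (event : pred sgraph) : R :=
  #|[set H in edge_samples G m | event H]|%:R / #|edge_samples G m|%:R.

Lemma card_edge_samples (G : sgraph) (m : nat) :
  #|edge_samples G m| = 'C(edge_count G, m).
Proof.
rewrite -cards_draws -(card_imset _ (val_inj : injective edges)).
congr #|pred_of_set _|; apply/setP => F; rewrite inE; apply/imsetP/idP.
  by move=> [H]; rewrite inE => hH ->.
move=> /andP[FG Fm].
have F2 : [forall e in F, #|e| == 2].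
  apply/forall_inP => e eF.
  exact: (forall_inP (edges_pairs G)) (subsetP FG _ eF).
by exists (SGraph F2); rewrite // inE FG.
Qed.

End Graph.

(* Main.v *)
Require Import Defs.
From mathcomp Require Import all_boot all_order all_algebra.
From mathcomp Require Import ring lra.
From mathcomp Require Import reals.

(** Let [P] be an optimal partition of [G], and keep it for every sample [H].
    For a part [A] let [share A e] be the fraction of the endpoints of the edge
    [e] lying in [A].  Then [vol H A / (2 m)] is the mean of [share A] over the
    edges of [H], so the score of [P] on [H] is a mean over edges minus a sum of
    squares of means over edges ([modularity_score_mean]).  Expanding the squares
    around the corresponding means over [edges G] gives
    (score of [P] on [H]) - (score of [P] on [G])
      = (mean_H gain - mean_G gain) - \sum_A (mean_H share_A - mean_G share_A)^2
    where [gain] is a bounded edge weight that depends only on [G] and [P]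
    ([modularity_score_diff]).

    The mean of [m] edges drawn without replacement deviates from the population
    mean of a weight [f] by at most mean_G (f^2) / m in mean square
    ([sum_draws_mean_dev_le]).  As [gain ^ 2 <= 4], the square of the linear term
    has expectation at most [4 / m].  As the shares of an edge are nonnegative
    with sum 1, their squares sum to at most 1, so the quadratic term has
    expectation at most [1 / m], however many parts [P] has.  This independence
    of the number of parts is why the threshold on [m] depends on [eps] only.
    A loss of at least [eps] forces one of the two terms to be at least
    [eps / 2] in absolute value, and Markov's inequality, applied to a single
    nonnegative combination of the two, bounds the number of such samples. *)

Set Implicit Arguments.
Unset Strict Implicit.
Unset Printing Implicit Defensive.

Import Order.TTheory GRing.Theory Num.Theory.
Local Open Scope ring_scope.

(** * Sampling without replacement *)

Definition draws (T : finType) (E : {set T}) (m : nat) : {set {set T}} :=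
  [set S : {set T} | (S \subset E) && (#|S| == m)].

Definition mean (R : realFieldType) (T : finType) (S : {set T}) (f : T -> R) : R :=
  (\sum_(x in S) f x) / #|S|%:R.

Lemma sum_bool_card (T : finType) (A : {set T}) (p : pred T) :
  (\sum_(x in A) p x)%N = #|[set x in A | p x]|.
Proof. by rewrite -big_mkcondr sum1dep_card. Qed.

(** Complementing inside [E] turns the draws containing [X] into the subsets of
    [E :\: X] of size [#|E| - m].  Counting them this way, the binomial also gives
    the right value 0 when [m < #|X|], where ['C(#|E| - #|X|, m - #|X|)] would
    not. *)
Lemma card_draws_supset (T : finType) (E X : {set T}) (m : nat) :
  X \subset E -> (m <= #|E|)%N ->
  #|[set S in draws E m | X \subset S]| = 'C(#|E| - #|X|, #|E| - m).
Proof.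
move=> XE mE; rewrite -cardsDS // -cards_draws.
have inj : {in [set S in draws E m | X \subset S] &, injective (setD E)}.
  move=> S S'; rewrite !inE => /andP[/andP[SE _] _] /andP[/andP[S'E _] _] eqD.
  have DK (U : {set T}) : U \subset E -> E :\: (E :\: U) = U.
    by move=> UE; rewrite setDDr setDv set0U; exact/setIidPr.
  by rewrite -(DK S) // eqD DK.
rewrite -(card_in_imset inj); congr #|pred_of_set _|; apply/setP => D.
rewrite inE; apply/imsetP/andP => [[S]|[DEX /eqP cD]].
  rewrite !inE => /andP[/andP[SE /eqP cS] XS] ->.
  by rewrite setDS // cardsDS // cS.
have [DE /disjoint_setI0 DX] : D \subset E /\ [disjoint D & X].
  by move: DEX; rewrite subsetD => /andP[].
exists (E :\: D); last first.
  by rewrite setDDr setDv set0U; apply/esym/setIidPr.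
rewrite !inE subsetDl cardsDS // cD subKn // eqxx /=.
by rewrite subsetD XE -setI_eq0 setIC DX eqxx.
Qed.

(** Membership of two distinct elements in a random draw is negatively
    correlated.  All pairs of distinct elements lie in the same number [b] of
    draws, and every element lies in [a >= b] of them, so for centered weights the
    cross terms contribute [- b * \sum h ^ 2]: the sum is exactly
    [(a - b) * \sum h ^ 2]. *)
Lemma sum_draws_sqr_le (R : realFieldType) (T : finType) (E : {set T}) (m : nat)
    (h : T -> R) :
  (m <= #|E|)%N -> \sum_(x in E) h x = 0 ->
  \sum_(S in draws E m) (\sum_(x in S) h x) ^+ 2
    <= 'C(#|E|.-1, #|E| - m)%:R * \sum_(x in E) h x ^+ 2.
Proof.
move=> mE h0.
set a := 'C(_, _); pose b := 'C(#|E| - 2, #|E| - m).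
have pairs x y : x \in E -> y \in E ->
    \sum_(S in draws E m) ((x \in S) && (y \in S))%:R
      = b%:R + (x == y)%:R * (a%:R - b%:R) :> R.
  move=> xE yE; rewrite -natr_sum sum_bool_card.
  have -> : #|[set S in draws E m | (x \in S) && (y \in S)]|
      = #|[set S in draws E m | [set x; y] \subset S]|.
    by apply: eq_card => S; rewrite !inE subUset !sub1set.
  rewrite card_draws_supset //; last by rewrite subUset !sub1set xE.
  rewrite cards2; case: eqP => _ /=; last by rewrite mul0r addr0.
  by rewrite subn1 mul1r addrC subrK.
have -> : \sum_(S in draws E m) (\sum_(x in S) h x) ^+ 2 =
    \sum_(x in E) \sum_(y in E)
      h x * h y * (b%:R + (x == y)%:R * (a%:R - b%:R)).
  transitivity (\sum_(S in draws E m) \sum_(x in E) \sum_(y in E)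
      h x * h y * ((x \in S) && (y \in S))%:R).
    apply: eq_bigr => S; rewrite inE => /andP[SE _].
    have -> : \sum_(x in S) h x = \sum_(x in E) h x * (x \in S)%:R.
      rewrite [RHS](big_setID S) /= (setIidPr SE) [X in _ = _ + X]big1 => [|x].
        by rewrite addr0; apply: eq_bigr => x ->; rewrite mulr1.
      by rewrite inE => /andP[/negbTE-> _]; rewrite mulr0.
    rewrite expr2 mulr_suml; apply: eq_bigr => x _.
    rewrite mulr_sumr; apply: eq_bigr => y _.
    by rewrite -mulnb natrM mulrACA.
  rewrite exchange_big; apply: eq_bigr => x xE.
  rewrite exchange_big; apply: eq_bigr => y yE.
  by rewrite -mulr_sumr pairs.
have row x : x \in E -> \sum_(y in E)
    h x * h y * (b%:R + (x == y)%:R * (a%:R - b%:R)) = h x ^+ 2 * (a%:R - b%:R).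
  move=> xE.
  under eq_bigr do rewrite mulrDr.
  rewrite big_split /= -mulr_suml -mulr_sumr h0 mulr0 mul0r add0r.
  rewrite (bigD1 x) //= eqxx mul1r big1 ?addr0 // => y /andP[_ /negbTE].
  by rewrite eq_sym => ->; rewrite mul0r mulr0.
rewrite (eq_bigr _ row) -mulr_suml mulrC ler_wpM2r ?gerBl //.
by apply: sumr_ge0 => x _; exact: sqr_ge0.
Qed.

(** The variance bound for independent draws also holds for draws without
    replacement: it is [sum_draws_sqr_le] for [f] centered at its mean, since
    centering only decreases the sum of squares. *)
Lemma sum_draws_mean_dev_le (R : realFieldType) (T : finType) (E : {set T})
    (m : nat) (f : T -> R) :
  (0 < m <= #|E|)%N ->
  \sum_(S in draws E m) (mean S f - mean E f) ^+ 2
    <= #|draws E m|%:R / m%:R * mean E (fun x => f x ^+ 2).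
Proof.
move=> /andP[m_gt0 mE]; set mu := mean E f.
have mR : 0 < m%:R :> R by rewrite ltr0n.
have ER : 0 < #|E|%:R :> R by rewrite ltr0n (leq_trans m_gt0).
have sumE : \sum_(x in E) f x = #|E|%:R * mu.
  by rewrite /mu /mean mulrC divfK ?gt_eqF.
pose h x := f x - mu.
have h0 : \sum_(x in E) h x = 0.
  by rewrite sumrB sumr_const sumE -[mu *+ _]mulr_natl subrr.
have dev S : S \in draws E m ->
    (mean S f - mu) ^+ 2 = m%:R ^- 2 * (\sum_(x in S) h x) ^+ 2.
  rewrite inE => /andP[_ /eqP cS].
  rewrite sumrB sumr_const -[mu *+ _]mulr_natl /mean cS.
  by field; rewrite gt_eqF.
rewrite (eq_bigr _ dev) -mulr_sumr.
have h2 : \sum_(x in E) h x ^+ 2 <= \sum_(x in E) f x ^+ 2.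
  have -> : \sum_(x in E) h x ^+ 2 = \sum_(x in E) f x ^+ 2 - #|E|%:R * mu ^+ 2.
    have hE x : h x ^+ 2 = f x ^+ 2 - 2 * mu * f x + mu ^+ 2 by rewrite /h; ring.
    under eq_bigr do rewrite hE.
    rewrite big_split sumrB /= sumr_const -mulr_sumr sumE.
    by rewrite -[mu ^+ 2 *+ _]mulr_natl; ring.
  by rewrite gerBl mulr_ge0 ?sqr_ge0 // ltW.
have binE : (#|E| * 'C(#|E|.-1, #|E| - m) = m * 'C(#|E|, m))%N.
  by rewrite mul_bin_down subKn // bin_sub.
have -> : #|draws E m|%:R / m%:R * mean E (fun x => f x ^+ 2) =
    m%:R ^- 2 * ('C(#|E|.-1, #|E| - m)%:R * \sum_(x in E) f x ^+ 2).
  have /(congr1 (fun n => n%:R : R)) := binE; rewrite !natrM => binER.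
  have -> : 'C(#|E|.-1, #|E| - m)%:R = m%:R * 'C(#|E|, m)%:R / #|E|%:R :> R.
    by rewrite -binER mulrC mulKf ?gt_eqF.
  rewrite cards_draws /mean; field; by rewrite !gt_eqF.
rewrite ler_pM2l ?invr_gt0 ?exprn_gt0 //.
apply: le_trans (sum_draws_sqr_le mE h0) _.
by rewrite ler_wpM2l.
Qed.

(** * Modularity through averages over edges *)

(** The factor 1/2 makes the shares of an edge over the parts of a partition a
    probability distribution. *)
Definition share (R : realFieldType) (V : finType) (A e : {set V}) : R :=
  #|A :&: e|%:R / 2.

Definition inside (R : realFieldType) (V : finType) (P : {set {set V}})
    (e : {set V}) : R :=
  \sum_(A in P) (e \subset A)%:R.

Lemma share_ge0 (R : realFieldType) (V : finType) (A e : {set V}) :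
  0 <= share R A e.
Proof. by rewrite divr_ge0. Qed.

Lemma share_le1 (R : realFieldType) (V : finType) (A e : {set V}) :
  #|e| = 2%N -> share R A e <= 1.
Proof.
move=> e2; rewrite ler_pdivrMr ?ltr0n // mul1r ler_nat -e2.
exact/subset_leq_card/subsetIr.
Qed.

Lemma sum_share (R : realFieldType) (V : finType) (P : {set {set V}})
    (e : {set V}) :
  partition P [set: V] -> #|e| = 2%N -> \sum_(A in P) share R A e = 1.
Proof.
move=> hP e2; rewrite -mulr_suml.
have cI A : #|A :&: e|%:R = \sum_(x in A) (x \in e)%:R :> R.
  rewrite -natr_sum sum_bool_card.
  by have -> : A :&: e = [set x in A | x \in e] by apply/setP => x; rewrite !inE.
under eq_bigr do rewrite cI.
rewrite -(set_partition_big _ hP) -natr_sum sum_bool_card.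
have -> : [set x in [set: V] | x \in e] = e by apply/setP => x; rewrite !inE.
by rewrite e2 divff ?pnatr_eq0.
Qed.

(** An edge inside [A] has its full share there, so the number of parts containing
    it is at most the sum of its shares. *)
Lemma inside_bounds (R : realFieldType) (V : finType) (P : {set {set V}})
    (e : {set V}) :
  partition P [set: V] -> #|e| = 2%N -> 0 <= inside R P e <= 1.
Proof.
move=> hP e2; rewrite sumr_ge0 //= -(sum_share R hP e2).
apply: ler_sum => A _; case: (boolP (e \subset A)) => eA; last exact: share_ge0.
by rewrite /share (setIidPr eA) e2 divff ?pnatr_eq0.
Qed.

Lemma card_edge (V : finType) (G : sgraph V) e : e \in edges G -> #|e| = 2%N.
Proof. by move=> eG; apply/eqP; exact: (forall_inP (edges_pairs G)). Qed.

Lemma mean_ge0 (R : realFieldType) (T : finType) (S : {set T}) (f : T -> R) :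
  {in S, forall x, 0 <= f x} -> 0 <= mean S f.
Proof. by move=> f0; rewrite divr_ge0 ?sumr_ge0. Qed.

Lemma mean_le (R : realFieldType) (T : finType) (S : {set T}) (f : T -> R) c :
  0 <= c -> {in S, forall x, f x <= c} -> mean S f <= c.
Proof.
move=> c0 fc; rewrite /mean; have [->|S0] := posnP #|S|.
  by rewrite invr0 mulr0.
rewrite ler_pdivrMr ?ltr0n // mulr_natr -sumr_const.
exact: ler_sum.
Qed.

Lemma vol_sum_edges (V : finType) (G : sgraph V) (A : {set V}) :
  vol G A = (\sum_(e in edges G) #|A :&: e|)%N.
Proof.
rewrite /vol /degree.
transitivity (\sum_(v in A) \sum_(e in edges G) (v \in e))%N.
  by apply: eq_bigr => v _; rewrite sum_bool_card.
rewrite exchange_big; apply: eq_bigr => e _.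
by rewrite sum_bool_card; apply: eq_card => v; rewrite !inE.
Qed.

Lemma modularity_score_mean (R : realType) (V : finType) (G : sgraph V)
    (P : {set {set V}}) :
  modularity_score R G P
    = mean (edges G) (inside R P)
      - \sum_(A in P) mean (edges G) (share R A) ^+ 2.
Proof.
have volE A : mean (edges G) (share R A) = (vol G A)%:R / (2 * (edge_count G)%:R).
  by rewrite vol_sum_edges natr_sum /mean -mulr_suml invfM mulrA.
under [X in _ - X]eq_bigr do rewrite volE.
rewrite /modularity_score /mean /inside -/(edge_count G).
case: eqP => [->|/eqP m0].
  by rewrite invr0 !mulr0 big1 ?subrr // => A _; rewrite invr0 mulr0 expr0n.
congr (_ - _).
  rewrite mulrC exchange_big; congr (_ / _); apply: eq_bigr => A _.
  by rewrite -natr_sum sum_bool_card.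
rewrite mulr_sumr; apply: eq_bigr => A _.
by field; rewrite pnatr_eq0.
Qed.

(** The coefficient of the edge [e] in the linearization at [G] of the score of
    [P]: differentiating the tax \sum_A y_A^2 at the mean shares [y_A] of [G]
    produces the factor [2 * y_A]. *)
Definition gain (R : realFieldType) (V : finType) (G : sgraph V)
    (P : {set {set V}}) (e : {set V}) : R :=
  inside R P e - 2 * \sum_(A in P) mean (edges G) (share R A) * share R A e.

Lemma gain_sqr_le4 (R : realFieldType) (V : finType) (G : sgraph V)
    (P : {set {set V}}) (e : {set V}) :
  partition P [set: V] -> #|e| = 2%N -> gain R G P e ^+ 2 <= 4.
Proof.
move=> hP e2; rewrite /gain.
have /andP[i0 i1] := inside_bounds R hP e2.
set s := \sum_(A in P) _.
have y0 A : 0 <= mean (edges G) (share R A).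
  by apply: mean_ge0 => x _; exact: share_ge0.
have s0 : 0 <= s.
  by apply: sumr_ge0 => A _; rewrite mulr_ge0 ?share_ge0.
have s1 : s <= 1.
  rewrite -(sum_share R hP e2); apply: ler_sum => A _.
  rewrite ler_piMl ?share_ge0 // mean_le // => f /card_edge; exact: share_le1.
nra.
Qed.

(** The only nonlinear part of the score is minus the sum of the squares of the
    mean shares, so its expansion at [G] stops at the second order. *)
Lemma modularity_score_diff (R : realType) (V : finType) (G H : sgraph V)
    (P : {set {set V}}) :
  modularity_score R H P - modularity_score R G P
    = mean (edges H) (gain R G P) - mean (edges G) (gain R G P)
      - \sum_(A in P)
          (mean (edges H) (share R A) - mean (edges G) (share R A)) ^+ 2.
Proof.
have meanE K : mean (edges K) (gain R G P) = mean (edges K) (inside R P)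
    - 2 * \sum_(A in P)
        mean (edges G) (share R A) * mean (edges K) (share R A).
  rewrite {1}/mean /gain sumrB mulrBl; congr (_ - _).
  rewrite -mulr_sumr -mulrA exchange_big mulr_suml; congr (2 * _).
  by apply: eq_bigr => A _; rewrite -mulr_sumr -mulrA.
rewrite !modularity_score_mean !meanE.
have -> : \sum_(A in P)
    (mean (edges H) (share R A) - mean (edges G) (share R A)) ^+ 2 =
    \sum_(A in P) mean (edges H) (share R A) ^+ 2
    - 2 * \sum_(A in P) mean (edges G) (share R A) * mean (edges H) (share R A)
    + \sum_(A in P) mean (edges G) (share R A) ^+ 2.
  rewrite mulr_sumr -sumrB -big_split; apply: eq_bigr => A _ /=; ring.
have -> : \sum_(A in P) mean (edges G) (share R A) * mean (edges G) (share R A)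
   = \sum_(A in P) mean (edges G) (share R A) ^+ 2 by [].
ring.
Qed.

(** * Random subgraphs *)

Lemma sum_edge_samples (R : realFieldType) (V : finType) (G : sgraph V) (m : nat)
    (F : {set {set V}} -> R) :
  \sum_(H in edge_samples G m) F (edges H) = \sum_(S in draws (edges G) m) F S.
Proof.
rewrite -(big_imset _ (in2W val_inj)); apply: eq_bigl => S.
rewrite inE; apply/imsetP/andP => [[H]|[SG /eqP Sm]].
  by rewrite inE => /andP[HG Hm] ->.
have S2 : [forall e in S, #|e| == 2].
  by apply/forall_inP => e /(subsetP SG); exact: (forall_inP (edges_pairs G)).
by exists (SGraph S2) => //; rewrite inE SG /edge_count /= Sm eqxx.
Qed.

Lemma sum_edge_samples_mean_dev_le (R : realFieldType) (V : finType)
    (G : sgraph V) (m : nat) (f : {set V} -> R) :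
  (0 < m <= edge_count G)%N ->
  \sum_(H in edge_samples G m) (mean (edges H) f - mean (edges G) f) ^+ 2
    <= #|edge_samples G m|%:R / m%:R * mean (edges G) (fun e => f e ^+ 2).
Proof.
move=> hm; rewrite (sum_edge_samples G m
  (fun S => (mean S f - mean (edges G) f) ^+ 2)) card_edge_samples -cards_draws.
exact: sum_draws_mean_dev_le.
Qed.

Theorem corollary1p3 (R : realType) (eps : R) (eps_gt0 : 0 < eps) :
  exists m0 : nat, forall (V : finType) (G : sgraph V) (m : nat),
    (m0 <= m <= edge_count G)%N ->
    1 - eps <
      sample_prob R G m [pred H | modularity R G - eps < modularity R H].
Proof.
(* Markov's inequality below bounds the failure probability by [c / m]. *)
pose c : R := 16 / eps ^+ 2 + 2 / eps.
have c0 : 0 < c by rewrite addr_gt0 ?divr_gt0 ?exprn_gt0.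
exists (Num.bound (c / eps)) => V G m /andP[m0m mG].
have cm : c / eps < m%:R.
  apply: lt_le_trans (_ : (Num.bound (c / eps))%:R <= _); last by rewrite ler_nat.
  exact/archi_boundP/ltW/divr_gt0.
have mR : 0 < m%:R :> R by apply: lt_trans cm; exact: divr_gt0.
have hm : (0 < m <= edge_count G)%N by rewrite mG -(ltr0n R) mR.
set N := edge_samples G m.
have N0 : 0 < #|N|%:R :> R by rewrite ltr0n card_edge_samples bin_gt0.
have [P hP PG] := modularity_attained R G.
pose lin (H : sgraph V) : R :=
  (mean (edges H) (gain R G P) - mean (edges G) (gain R G P)) ^+ 2.
pose quad (H : sgraph V) : R := \sum_(A in P)
  (mean (edges H) (share R A) - mean (edges G) (share R A)) ^+ 2.
have sum_lin : \sum_(H in N) lin H <= #|N|%:R / m%:R * 4.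
  apply: le_trans (sum_edge_samples_mean_dev_le _ hm) _.
  rewrite ler_wpM2l ?divr_ge0 // mean_le // => e /card_edge; exact: gain_sqr_le4.
have sum_quad : \sum_(H in N) quad H <= #|N|%:R / m%:R.
  rewrite exchange_big /=.
  apply: le_trans (ler_sum _ (fun A _ => sum_edge_samples_mean_dev_le _ hm)) _.
  rewrite -mulr_sumr ler_piMr ?divr_ge0 //.
  rewrite -mulr_suml exchange_big -/(mean (edges G)
    (fun e => \sum_(A in P) share R A e ^+ 2)).
  apply: mean_le => // e /card_edge e2; rewrite -(sum_share R hP e2).
  apply: ler_sum => A _; rewrite expr2 ler_piMr ?share_ge0 //.
  exact: share_le1.
pose good : pred (sgraph V) := [pred H | modularity R G - eps < modularity R H].
(* The coefficients make the cost at least 1 as soon as the linear deviation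
   or the quadratic term reaches eps / 2 in absolute value. *)
pose cost H : R := 4 / eps ^+ 2 * lin H + 2 / eps * quad H.
have lin0 H : 0 <= lin H by exact: sqr_ge0.
have quad0 H : 0 <= quad H by apply: sumr_ge0 => A _; exact: sqr_ge0.
have cost0 H : 0 <= cost H.
  by rewrite addr_ge0 // mulr_ge0 // divr_ge0 ?exprn_ge0 // ltW.
have bad_cost H : ~~ good H -> 1 <= cost H.
  rewrite /= -leNgt => bad.
  have : modularity_score R H P - modularity_score R G P <= - eps.
    by have := modularity_ub R H hP; rewrite -PG; lra.
  rewrite modularity_score_diff -/(quad H) => le_eps.
  have [q_small|q_big] := ltP (quad H) (eps / 2); last first.
    have : 1 <= 2 / eps * quad H.
      by rewrite mulrAC ler_pdivlMr // mul1r; lra.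
    have : 0 <= 4 / eps ^+ 2 * lin H.
      by rewrite mulr_ge0 // divr_ge0 ?exprn_ge0 // ltW.
    by rewrite /cost; lra.
  have : 1 <= 4 / eps ^+ 2 * lin H.
    by rewrite mulrAC ler_pdivlMr ?exprn_gt0 // mul1r /lin; nra.
  have : 0 <= 2 / eps * quad H by rewrite mulr_ge0 // divr_ge0 // ltW.
  by rewrite /cost; lra.
have few_bad : #|[set H in N | ~~ good H]|%:R < eps * #|N|%:R.
  apply: (@le_lt_trans _ _ (\sum_(H in N) cost H)).
    rewrite -sum1dep_card natr_sum big_mkcondr; apply: ler_sum => H _.
    by case: ifP => // /bad_cost.
  apply: (@le_lt_trans _ _ (c * (#|N|%:R / m%:R))).
    rewrite big_split /= -!mulr_sumr /c [leRHS]mulrDl; apply: lerD.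
      have -> : 16 / eps ^+ 2 * (#|N|%:R / m%:R)
        = 4 / eps ^+ 2 * (#|N|%:R / m%:R * 4) by ring.
      by rewrite ler_wpM2l // divr_ge0 ?exprn_ge0 // ltW.
    by rewrite ler_wpM2l // divr_ge0 // ltW.
  rewrite mulrCA [ltRHS]mulrC ltr_pM2l //.
  by rewrite ltr_pdivrMr // mulrC -ltr_pdivrMr.
have split_good : #|N|%:R = #|[set H in N | good H]|%:R
    + #|[set H in N | ~~ good H]|%:R :> R.
  rewrite -natrD -(cardsID [set H | good H] N); congr ((_ + _)%:R).
    by apply: eq_card => H; rewrite !inE.
  by apply: eq_card => H; rewrite !inE andbC.
rewrite /sample_prob -/N -/good ltr_pdivlMr //; lra.
Qed.
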